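(* Let $n\ge1$, let $\mathcal W$ be the Walsh algebra of dimension $2^n$, let $\widehat f\in\mathcal W$ and $p\in\{0,1,\ldots,2^n-1\}$. Then $\widehat f$ is a zero divisor of rank $p$ if and only if $\widehat f\,\widehat e_p=\widehat 0$.
   Context: The Walsh algebra is $\mathcal W=U_0\otimes\cdots\otimes U_{n-1}$, the tensor product over $\mathbb R$ of $n$ two-dimensional commutative associative unital real algebras $U_k$ with bases $\{\widehat 1_k,\widehat u_k\}$, $\widehat u_k^2=\widehat 1_k$ ($\widehat 1_k$ the unit); its unit is $\widehat 1$. For $p=(p_0p_1\ldots p_{n-1})_2$ put $\widehat e_p=\frac1{2^n}\prod_{k=0}^{n-1}[\widehat 1+(-1)^{p_k}\widehat u_k]$; the family $\{\widehat e_p\}_{p=0}^{2^n-1}$ is a basis of $\mathcal W$ consisting of orthogonal idempotents. Writing $\widehat f=\sum_{p=0}^{2^n-1}a_p\widehat e_p$ with $a_p\in\mathbb R$, the element $\widehat f$ is called a zero divisor of rank $p$ if $a_p=0$. *)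

(* Defs.v *)
From HB Require Import structures.
From mathcomp Require Import all_boot all_order all_algebra.
From mathcomp Require Import reals.
From mathcomp Require Import ring.

Set Implicit Arguments.
Unset Strict Implicit.
Unset Printing Implicit Defensive.

Import Order.TTheory GRing.Theory Num.Theory.
Local Open Scope ring_scope.

(* The two-dimensional algebra U = R 1 (+) R u with u^2 = 1: an element is its
   family of coordinates, [false] being the index of 1 and [true] that of u. *)
Definition ualg (R : realType) : Type := {ffun bool -> R^o}.

HB.instance Definition _ (R : realType) := Choice.on (ualg R).
HB.instance Definition _ (R : realType) := GRing.Lmodule.on (ualg R).
HB.instance Definition _ (R : realType) := Vector.on (ualg R).

Definition ubase (R : realType) (b : bool) : ualg R :=
  [ffun c => (c == b)%:R].

Definition ugen (R : realType) : ualg R := ubase R true.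

Section UalgRing.
Variable R : realType.
Implicit Types x y z : ualg R.

Definition ualg_mul x y : ualg R :=
  [ffun b : bool => if b then x false * y true + x true * y false
                    else x false * y false + x true * y true].

Fact ualg_mulA : associative ualg_mul.
Proof. by move=> x y z; apply/ffunP => -[]; rewrite !ffunE; ring. Qed.

Fact ualg_mulC : commutative ualg_mul.
Proof. by move=> x y; apply/ffunP => -[]; rewrite !ffunE; ring. Qed.

Fact ualg_mul1 : left_id (ubase R false) ualg_mul.
Proof.
by move=> x; apply/ffunP => -[]; rewrite !ffunE /= ?mul1r mul0r addr0.
Qed.

Fact ualg_mulDl : left_distributive ualg_mul +%R.
Proof. by move=> x y z; apply/ffunP => -[]; rewrite !ffunE; ring. Qed.

Fact ualg_oner_neq0 : ubase R false != 0.
Proof. by apply/eqP => /ffunP/(_ false)/eqP; rewrite !ffunE /= oner_eq0. Qed.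

HB.instance Definition _ := GRing.Zmodule_isComNzRing.Build (ualg R)
  ualg_mulA ualg_mulC ualg_mul1 ualg_mulDl ualg_oner_neq0.

Fact ualg_scaleAl (a : R) x y : a *: (x * y) = (a *: x) * y.
Proof.
by apply/ffunP => -[]; rewrite !ffunE -[LHS]/(a * _) mulrDr !mulrA.
Qed.

HB.instance Definition _ :=
  GRing.Lmodule_isLalgebra.Build R (ualg R) ualg_scaleAl.
HB.instance Definition _ := GRing.Lalgebra_isComAlgebra.Build R (ualg R).

Lemma ubase_false : ubase R false = 1. Proof. by []. Qed.

Lemma ugen_sqr : ugen R * ugen R = 1.
Proof.
by apply/ffunP => -[]; rewrite !ffunE /= ?(mulr0, mul0r, mulr1, addr0, add0r).
Qed.

Lemma ualg_mulE x y (b : bool) :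
  (x * y) b = \sum_c \sum_d x c * y d * (ubase R c * ubase R d) b.
Proof.
by rewrite !big_bool /= !ffunE; case: b => /=; ring.
Qed.

End UalgRing.

(* U_0 (x) ... (x) U_{n-1}, all U_k being copies of U: an element is its family
   of coordinates on the basis of the pure tensors (x)_k ubase (s k), indexed
   by s : {0, ..., n-1} -> bool. *)
Definition walsh (R : realType) (n : nat) : Type :=
  {ffun {ffun 'I_n -> bool} -> R^o}.

HB.instance Definition _ (R : realType) n := Choice.on (walsh R n).
HB.instance Definition _ (R : realType) n := GRing.Lmodule.on (walsh R n).
HB.instance Definition _ (R : realType) n := Vector.on (walsh R n).

(* The pure tensor x_0 (x) ... (x) x_{n-1}. *)
Definition tens (R : realType) (n : nat) (x : 'I_n -> ualg R) : walsh R n :=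
  [ffun s : {ffun 'I_n -> bool} => \prod_(k < n) x k (s k)].

Section WalshRing.
Variables (R : realType) (n : nat).
Implicit Types (x y : 'I_n -> ualg R) (s t : {ffun 'I_n -> bool}).
Implicit Types f g h : walsh R n.

Definition tbase s : walsh R n := tens (fun k => ubase R (s k)).

(* The bilinear extension of ((x)_k a_k) ((x)_k b_k) = (x)_k (a_k b_k) from the
   basis; see [tensM] for arbitrary pure tensors. *)
Definition walsh_mul f g : walsh R n :=
  \sum_s \sum_t (f s * g t) *: tens (fun k => ubase R (s k) * ubase R (t k)).

Lemma eq_tens x y : x =1 y -> tens x = tens y.
Proof. by move=> e; apply/ffunP => s; rewrite !ffunE; apply: eq_bigr => k _; rewrite e. Qed.

Lemma walsh_scaleE (a : R) f s : (a *: f) s = a * f s.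
Proof. by rewrite ffunE. Qed.

Lemma walsh_mulE f g s : walsh_mul f g s =
  \sum_t \sum_u f t * g u * \prod_(k < n) (ubase R (t k) * ubase R (u k)) (s k).
Proof.
rewrite sum_ffunE; apply: eq_bigr => t _; rewrite sum_ffunE.
by apply: eq_bigr => u _; rewrite walsh_scaleE [X in _ * X]ffunE.
Qed.

Lemma walsh_mul_tens x y :
  walsh_mul (tens x) (tens y) = tens (fun k => x k * y k).
Proof.
apply/ffunP => s; rewrite walsh_mulE [RHS]ffunE.
under [RHS]eq_bigr => k _ do rewrite ualg_mulE.
rewrite (bigA_distr_bigA (fun k c => \sum_d x k c * y k d * (ubase R c * ubase R d) (s k))).
apply: eq_bigr => t _.
rewrite (bigA_distr_bigA (fun k d => x k (t k) * y k d * (ubase R (t k) * ubase R d) (s k))).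
by apply: eq_bigr => u _; rewrite !big_split !ffunE.
Qed.

Lemma tbaseE s t : tbase s t = (t == s)%:R.
Proof.
rewrite ffunE; have [->|ne] := eqVneq t s.
  by rewrite big1 // => k _; rewrite ffunE eqxx.
have [k nek] : exists k, t k != s k.
  apply/existsP; rewrite -negb_forall; apply: contra ne => /forallP e.
  by apply/eqP/ffunP => k; apply/eqP.
by rewrite (bigD1 k) //= ffunE (negbTE nek) mul0r.
Qed.

Lemma walsh_expand f : f = \sum_s f s *: tbase s.
Proof.
apply/ffunP => t; rewrite sum_ffunE (bigD1 t) //= walsh_scaleE tbaseE eqxx mulr1.
rewrite big1 ?addr0 // => s; rewrite eq_sym walsh_scaleE tbaseE => /negbTE ->.
by rewrite mulr0.
Qed.

Lemma walsh_ind (P : walsh R n -> Prop) : P 0 ->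
  (forall a s f, P f -> P (a *: tbase s + f)) -> forall f, P f.
Proof.
move=> P0 PS f; rewrite (walsh_expand f).
by elim: (index_enum _) => [|s r IH]; rewrite ?big_nil // big_cons; apply: PS.
Qed.

Fact walsh_mulC : commutative walsh_mul.
Proof.
move=> f g; rewrite /walsh_mul exchange_big; apply: eq_bigr => s _.
apply: eq_bigr => t _; rewrite mulrC; congr (_ *: _).
by apply: eq_tens => k; rewrite mulrC.
Qed.

Fact walsh_mul_linearl a f g h :
  walsh_mul (a *: f + g) h = a *: walsh_mul f h + walsh_mul g h.
Proof.
rewrite /walsh_mul scaler_sumr -big_split; apply: eq_bigr => s _ /=.
rewrite scaler_sumr -big_split; apply: eq_bigr => t _ /=.
have -> : (a *: f + g) s = a * f s + g s by rewrite !ffunE.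
by rewrite scalerA -scalerDl mulrDl mulrA.
Qed.

Fact walsh_mul_linearr a f g h :
  walsh_mul h (a *: f + g) = a *: walsh_mul h f + walsh_mul h g.
Proof. by rewrite walsh_mulC walsh_mul_linearl !(walsh_mulC h). Qed.

Fact walsh_mul0l h : walsh_mul 0 h = 0.
Proof.
by have := walsh_mul_linearl (-1) 0 0 h; rewrite scaler0 addr0 scaleN1r addNr.
Qed.

Fact walsh_mulA : associative walsh_mul.
Proof.
move=> f g h; have m0r g' : walsh_mul g' 0 = 0 by rewrite walsh_mulC walsh_mul0l.
elim/walsh_ind: f => [|a s f IHf]; first by rewrite !walsh_mul0l.
rewrite !walsh_mul_linearl {}IHf; congr (_ *: _ + _).
elim/walsh_ind: g => [|b t g IHg]; first by rewrite !(walsh_mul0l, m0r).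
rewrite !(walsh_mul_linearl, walsh_mul_linearr) {}IHg; congr (_ *: _ + _).
elim/walsh_ind: h => [|c u h IHh]; first by rewrite !m0r.
rewrite !walsh_mul_linearr {}IHh; congr (_ *: _ + _).
by rewrite !walsh_mul_tens; apply: eq_tens => k; rewrite mulrA.
Qed.

Fact walsh_mul1 : left_id (tens (fun=> 1)) walsh_mul.
Proof.
move=> f; elim/walsh_ind: f => [|a s f IHf]; first by rewrite walsh_mulC walsh_mul0l.
rewrite walsh_mul_linearr {}IHf walsh_mul_tens; congr (_ *: _ + _).
by apply: eq_tens => k; rewrite mul1r.
Qed.

Fact walsh_mulDl : left_distributive walsh_mul +%R.
Proof.
by move=> f g h; have := walsh_mul_linearl 1 f g h; rewrite !scale1r.
Qed.

Fact walsh_oner_neq0 : tens (fun=> 1) != 0 :> walsh R n.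
Proof.
apply/eqP => /ffunP/(_ [ffun=> false])/eqP; rewrite !ffunE big1 ?oner_eq0 // => k _.
by rewrite !ffunE.
Qed.

HB.instance Definition _ := GRing.Zmodule_isComNzRing.Build (walsh R n)
  walsh_mulA walsh_mulC walsh_mul1 walsh_mulDl walsh_oner_neq0.

Fact walsh_scaleAl (a : R) f g : a *: (f * g) = (a *: f) * g.
Proof.
have := walsh_mul_linearl a f 0 g; rewrite !addr0 walsh_mul0l addr0.
exact: esym.
Qed.

HB.instance Definition _ :=
  GRing.Lmodule_isLalgebra.Build R (walsh R n) walsh_scaleAl.
HB.instance Definition _ := GRing.Lalgebra_isComAlgebra.Build R (walsh R n).

Lemma tensM x y : tens x * tens y = tens (fun k => x k * y k).
Proof. exact: walsh_mul_tens. Qed.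

Lemma tens1 : tens (fun=> 1) = 1 :> walsh R n. Proof. by []. Qed.

End WalshRing.

(* The image 1 (x) ... (x) u (x) ... (x) 1 of the generator u of U_k. *)
Definition walsh_u (R : realType) (n : nat) (k : 'I_n) : walsh R n :=
  tens (fun j => if j == k then ugen R else 1).

(* The digit p_k of p = (p_0 p_1 ... p_{n-1})_2, where p_0 is the most
   significant digit. *)
Definition bit (n p k : nat) : nat := ((p %/ 2 ^ (n - k.+1)) %% 2)%N.

Definition walsh_e (R : realType) (n : nat) (p : 'I_(2 ^ n)) : walsh R n :=
  (2 ^+ n)^-1 *: \prod_(k < n) (1 + (-1) ^+ bit n p k *: walsh_u R k).

Definition walsh_basis (R : realType) (n : nat) : (2 ^ n).-tuple (walsh R n) :=
  [tuple walsh_e R p | p < 2 ^ n].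

Section WalshBasis.
Variables (R : realType) (n : nat).

Lemma eq_from_bits (m p q : nat) : (p < 2 ^ m)%N -> (q < 2 ^ m)%N ->
  (forall k, (k < m)%N -> ((p %/ 2 ^ k) %% 2 = (q %/ 2 ^ k) %% 2)%N) -> p = q.
Proof.
elim: m p q => [|m IH] p q; first by case: p q => [|p] [|q].
move=> ltp ltq e; rewrite (divn_eq p 2) (divn_eq q 2).
have := e 0 isT; rewrite !divn1 => ->; congr (_ * _ + _)%N.
apply: IH => [||k ltk]; rewrite ?ltn_divLR -?expnSr //.
by rewrite -!divnMA -expnS; apply: e.
Qed.

Lemma bit_inj (p q : 'I_(2 ^ n)) :
  (forall k, (k < n)%N -> bit n p k = bit n q k) -> p = q.
Proof.
move=> e; apply/val_inj; apply: (@eq_from_bits n); try exact: ltn_ord.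
move=> k ltk; have n_gt0 : (0 < n)%N by apply: leq_ltn_trans ltk.
have ltk' : (n - k.+1 < n)%N by rewrite ltn_subrL.
by have := e _ ltk'; rewrite /bit -subSn // subSS subKn ?(ltnW ltk).
Qed.

Definition uidem (b : nat) : ualg R := 2^-1 *: (1 + (-1) ^+ b *: ugen R).

Lemma uidemE b (c : bool) : uidem b c = if c then 2^-1 * (-1) ^+ b else 2^-1.
Proof.
have -> : uidem b c = 2^-1 * ((c == false)%:R + (-1) ^+ b * (c == true)%:R).
  by rewrite !ffunE.
by case: c; rewrite /= ?mulr0 ?mulr1 ?addr0 ?add0r ?mulr1.
Qed.

Lemma uidemM b c : (b < 2)%N -> (c < 2)%N ->
  uidem b * uidem c = (b == c)%:R *: uidem b.
Proof.
move=> ltb ltc; apply/ffunP => d.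
have -> : ((b == c)%:R *: uidem b) d = (b == c)%:R * uidem b d by rewrite !ffunE.
have -> : (uidem b * uidem c) d =
  if d then uidem b false * uidem c true + uidem b true * uidem c false
  else uidem b false * uidem c false + uidem b true * uidem c true.
  by rewrite [LHS]ffunE.
rewrite !uidemE.
by case: b c ltb ltc d => [|[|//]] [|[|//]] _ _ [] /=;
  rewrite ?expr0 ?expr1 ?eqxx /=; field.
Qed.

Lemma tens_prod (I : Type) (r : seq I) (X : I -> 'I_n -> ualg R) :
  \prod_(i <- r) tens (X i) = tens (fun k => \prod_(i <- r) X i k).
Proof.
elim: r => [|i r IH]; first by rewrite big_nil -tens1; apply: eq_tens => k; rewrite big_nil.
by rewrite big_cons IH tensM; apply: eq_tens => k; rewrite big_cons.
Qed.

Lemma walsh_eE (p : 'I_(2 ^ n)) : walsh_e R p = tens (fun k => uidem (bit n p k)).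
Proof.
pose v (k j : 'I_n) : ualg R :=
  if j == k then 1 + (-1) ^+ bit n p k *: ugen R else 1.
have -> : walsh_e R p = (2 ^+ n)^-1 *: \prod_(k < n) tens (v k).
  congr (_ *: _); apply: eq_bigr => k _; rewrite -tens1.
  apply/ffunP => s.
  have -> : (tens (fun=> 1) + (-1) ^+ bit n p k *: walsh_u R k) s =
     \prod_(j < n) (1 : ualg R) (s j) + (-1) ^+ bit n p k *
     \prod_(j < n) (if j == k then ugen R else 1) (s j) by rewrite !ffunE.
  rewrite [RHS]ffunE !(bigD1 k (P := xpredT)) //= /v eqxx.
  under [X in _ + _ * (_ * X)]eq_bigr => j /negbTE nj do rewrite nj.
  under [X in _ = _ * X]eq_bigr => j /negbTE nj do rewrite nj.
  rewrite mulrA -mulrDl; congr (_ * _).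
  by rewrite [RHS]ffunE; congr (_ + _); rewrite !ffunE.
rewrite tens_prod; apply/ffunP => s; rewrite walsh_scaleE !ffunE.
have -> : (2 ^+ n)^-1 = \prod_(k < n) 2^-1 :> R.
  by rewrite prodr_const card_ord exprVn.
rewrite -big_split; apply: eq_bigr => k _ /=.
rewrite (bigD1 k) //= [\prod_(i < n | _) _]big1 => [|j nj]; last first.
  by rewrite /v eq_sym (negbTE nj).
by rewrite mulr1 /v eqxx [RHS]ffunE.
Qed.

Lemma walsh_eM (p q : 'I_(2 ^ n)) :
  walsh_e R p * walsh_e R q = (p == q)%:R *: walsh_e R p.
Proof.
rewrite !walsh_eE tensM; have [->|ne] := eqVneq p q.
  rewrite scale1r; apply: eq_tens => k.
  by rewrite uidemM ?ltn_mod // eqxx scale1r.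
have [k nek] : exists k : 'I_n, bit n p k != bit n q k.
  apply/existsP; rewrite -negb_forall; apply: contra ne => /forallP e.
  by apply/eqP/bit_inj => k ltk; apply/eqP; apply: (e (Ordinal ltk)).
rewrite scale0r; apply/ffunP => s; rewrite !ffunE (bigD1 k) //=.
by rewrite uidemM ?ltn_mod // (negbTE nek) scale0r ffunE mul0r.
Qed.

Lemma walsh_e_neq0 (p : 'I_(2 ^ n)) : walsh_e R p != 0.
Proof.
rewrite walsh_eE; apply/eqP => /ffunP/(_ [ffun=> false])/eqP; apply/negP.
rewrite !ffunE; apply/prodf_neq0 => k _.
by rewrite uidemE ffunE invr_eq0 pnatr_eq0.
Qed.

Lemma walsh_basisP : basis_of fullv (walsh_basis R n).
Proof.
rewrite basisEfree subvf size_tuple dimvf /dim /= card_ffun card_bool card_ord.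
rewrite muln1 leqnn !andbT.
apply/(@freeP _ _ (2 ^ n) (walsh_basis R n)) => a sum0 p.
have nthE (q : 'I_(2 ^ n)) : (walsh_basis R n)`_q = walsh_e R q.
  by rewrite -tnth_nth tnth_mktuple.
have /eqP : (\sum_q a q *: (walsh_basis R n)`_q) * walsh_e R p = 0.
  by rewrite sum0 mul0r.
rewrite mulr_suml (bigD1 p) // big1 => [|q neqp]; rewrite nthE.
  by rewrite /= addr0 -scalerAl walsh_eM eqxx scale1r scaler_eq0
             (negbTE (walsh_e_neq0 p)) orbF => /eqP.
by rewrite -scalerAl walsh_eM (negbTE neqp) scale0r scaler0.
Qed.

End WalshBasis.

(* [coord] gives the coefficients a_p of f = \sum_p a_p e_p; they are well defined
   by [walsh_basisP]. *)
Definition zero_divisor_of_rank (R : realType) (n : nat) (p : 'I_(2 ^ n))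
    (f : walsh R n) : Prop :=
  coord (walsh_basis R n) p f = 0.

(* Main.v *)
Require Import Defs.
From mathcomp Require Import all_boot all_order all_algebra.
From mathcomp Require Import reals.
Import GRing.Theory.
Local Open Scope ring_scope.

(** The vectors [walsh_e R p] form a basis of orthogonal idempotents, so
    multiplying [f] by [walsh_e R p] kills every term of the expansion of [f]
    but the one of index [p]: every [walsh_e R p] is an eigenvector of the
    multiplication by [f], with eigenvalue the coordinate [a_p]
    ([walsh_mul_eigen]).  As [walsh_e R p] is nonzero, the product vanishes
    exactly when [a_p] does. *)

Lemma walsh_mul_eigen (R : realType) (n : nat) (f : walsh R n)
    (p : 'I_(2 ^ n)) :
  f * walsh_e R p = coord (walsh_basis R n) p f *: walsh_e R p.
Proof.
have nthE (q : 'I_(2 ^ n)) : (walsh_basis R n)`_q = walsh_e R q.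
  by rewrite -tnth_nth tnth_mktuple.
rewrite {1}(coord_basis (walsh_basisP R n) (memvf f)) mulr_suml.
rewrite (bigD1 p) // big1 => [|q neqp]; rewrite nthE -scalerAl walsh_eM.
  by rewrite /= addr0 eqxx scale1r.
by rewrite (negbTE neqp) scale0r scaler0.
Qed.

Theorem mainTheorem5 (R : realType) (n : nat) (hn : (1 <= n)%N)
    (f : walsh R n) (p : 'I_(2 ^ n)) :
  zero_divisor_of_rank p f <-> f * walsh_e R p = 0.
Proof.
rewrite /zero_divisor_of_rank walsh_mul_eigen; split=> [->|/eqP].
  by rewrite scale0r.
by rewrite scaler_eq0 (negbTE (walsh_e_neq0 R p)) orbF => /eqP.
Qed.
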